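(* Let $a>0$ be real. For a positive integer $m$ and $0\le r\le m$ let $f_{m,a}(r)=\frac{1}{(1+a)^r}\sum_{i=0}^{r}\binom{m}{i}a^i$, let $S_{m,a}=\sum_{r=0}^m f_{m,a}(r)$, and let $X_{m,a}$ be a random variable with $\mathrm{P}(X_{m,a}=r)=f_{m,a}(r)/S_{m,a}$ for $0\le r\le m$. Then, as $m\to\infty$, $$\mathbb{E}(X_{m,a})\sim\frac{am}{2a+1}+\frac{1}{a}.$$
   Context: Here $\sim$ denotes asymptotic equivalence as $m\to\infty$. *)

(* Defs.v *)
From HB Require Import structures.
From mathcomp Require Export all_boot all_order all_algebra.
From mathcomp Require Export all_classical all_reals all_analysis.

Set Implicit Arguments.
Unset Strict Implicit.
Unset Printing Implicit Defensive.

Import Order.TTheory GRing.Theory Num.Theory.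
Export numFieldNormedType.Exports.

Local Open Scope classical_set_scope.
Local Open Scope ring_scope.

Definition fdist (R : realType) (a : R) (m r : nat) : R :=
  1 / (1 + a) ^+ r * \sum_(0 <= i < r.+1) 'C(m, i)%:R * a ^+ i.

Definition Sdist (R : realType) (a : R) (m : nat) : R :=
  \sum_(0 <= r < m.+1) fdist a m r.

(* No separate support condition is needed: the weights sum to 1, so X lies
   almost surely in {0, ..., m}. *)
Definition has_law_f (R : realType) (a : R) (m : nat) (d : measure_display)
    (T : measurableType d) (P : probability T R) (X : {RV P >-> R}) : Prop :=
  forall r : nat, (r <= m)%N ->
    P (X @^-1` [set r%:R]) = (fdist a m r / Sdist a m)%:E.

(* Main.v *)
Require Import Defs.
From mathcomp Require Import measurable_realfun ring lra.

Set Implicit Arguments.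
Unset Strict Implicit.
Unset Printing Implicit Defensive.

Import Order.TTheory GRing.Theory Num.Theory.
Local Open Scope classical_set_scope.
Local Open Scope ring_scope.

(* Put b = 1 + a, q = 1 + a / b = (2a + 1) / b and g = a m / (2a + 1) + 1 / a.
   Summing over r first gives the closed forms a S = b q^m - 1 and
   a \sum_r r f(r) = b q^m g - (m + 1 + 1 / a), so that
   E(X) - g = (g - (m + 1 + 1 / a)) / (b q^m - 1). Since b q^m - 1 >= a m by
   Bernoulli's inequality, this difference is bounded in m, whereas g grows
   linearly. *)

(** Summation by parts. It removes the inner partial sum of binomial terms in [fdist] when the
    weight on that sum is a difference of consecutive [G]. *)
Lemma abel_summation (R : comPzRingType) (c G : nat -> R) (n : nat) :
  \sum_(0 <= r < n) (G r - G r.+1) * \sum_(0 <= i < r.+1) c i =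
  \sum_(0 <= i < n) c i * G i - G n * \sum_(0 <= i < n) c i.
Proof.
elim: n => [|n IHn]; first by rewrite !big_geq// mulr0 subr0.
rewrite big_nat_recr//= IHn !(big_nat_recr n)//=.
ring.
Qed.

Lemma binomial_gf (R : comPzRingType) (x : R) (m : nat) :
  \sum_(0 <= i < m.+1) 'C(m, i)%:R * x ^+ i = (1 + x) ^+ m.
Proof.
rewrite big_mkord exprDn; apply: eq_bigr => i _.
by rewrite expr1n mul1r mulr_natl.
Qed.

(** This is x d/dx of [binomial_gf], obtained algebraically from the absorption identity i C(m, i) =
    m C(m - 1, i - 1). *)
Lemma binomial_gf_deriv (R : comPzRingType) (x : R) (m : nat) :
  \sum_(0 <= i < m.+1) i%:R * ('C(m, i)%:R * x ^+ i) =
  m%:R * x * (1 + x) ^+ m.-1.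
Proof.
case: m => [|m]; first by rewrite big_nat1 !mul0r.
rewrite big_nat_recl// mul0r add0r -binomial_gf big_distrr/=.
apply: eq_bigr => i _.
by rewrite mulrA -natrM -mul_bin_diag natrM exprS; ring.
Qed.

Lemma bernoulli_ineq (R : realDomainType) (x : R) (n : nat) :
  0 <= x -> 1 + n%:R * x <= (1 + x) ^+ n.
Proof.
move=> x0; elim: n => [|n IHn]; first by rewrite mul0r addr0.
rewrite exprS -natr1.
have n0 : 0 <= n%:R :> R by [].
apply: (@le_trans _ _ ((1 + x) * (1 + n%:R * x))).
  by have := mulr_ge0 n0 (mulr_ge0 x0 x0); lra.
by rewrite ler_wpM2l// addr_ge0.
Qed.

(** Abel summation applied to [G r / (1 + a) ^+ r], whose differences are [g r / (1 + a) ^+ r]. In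
    the boundary term the full binomial sum [(1 + a) ^+ m] cancels all but one factor of the
    denominator. Summing a weight [g] thus reduces to finding a suitable [G]. *)
Lemma sum_fdist_telescope (R : realType) (a : R) (m : nat) (g G : nat -> R) :
  0 < a ->
  (forall r, g r = G r - G r.+1 / (1 + a)) ->
  \sum_(0 <= r < m.+1) g r * fdist a m r =
  \sum_(0 <= i < m.+1) G i * ('C(m, i)%:R * (a / (1 + a)) ^+ i)
  - G m.+1 / (1 + a).
Proof.
move=> a_gt0 gE.
have b_neq0 : 1 + a != 0 by rewrite gt_eqF// addr_gt0.
have := abel_summation (fun i => 'C(m, i)%:R * a ^+ i)
  (fun r => G r / (1 + a) ^+ r) m.+1.
rewrite binomial_gf => abel.
transitivity (\sum_(0 <= i < m.+1)
    'C(m, i)%:R * a ^+ i * (G i / (1 + a) ^+ i) -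
    G m.+1 / (1 + a) ^+ m.+1 * (1 + a) ^+ m).
  rewrite -abel; apply: eq_bigr => r _.
  rewrite gE /fdist exprS; have := expf_neq0 r b_neq0; set B := _ ^+ r => B0.
  by field; rewrite B0 b_neq0.
congr (_ - _).
  by apply: eq_bigr => i _; rewrite expr_div_n; ring.
rewrite exprS; have := expf_neq0 m b_neq0; set B := _ ^+ m => B0.
by field; rewrite B0 b_neq0.
Qed.

Lemma SdistE (R : realType) (a : R) (m : nat) : 0 < a ->
  a * Sdist a m = (1 + a) * (1 + a / (1 + a)) ^+ m - 1.
Proof.
move=> a_gt0; have a0 := lt0r_neq0 a_gt0.
have b_neq0 : 1 + a != 0 by rewrite gt_eqF// addr_gt0.
have -> : Sdist a m = \sum_(0 <= r < m.+1) 1 * fdist a m r.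
  by apply: eq_bigr => r _; rewrite mul1r.
(* The constant G with G - G / (1 + a) = 1 is (1 + a) / a. *)
rewrite (@sum_fdist_telescope _ _ m (fun=> 1) (fun=> (1 + a) / a))//.
  by rewrite -big_distrr/= binomial_gf; field; rewrite a0 b_neq0.
by move=> _; field; rewrite a0 b_neq0.
Qed.

(* [G r = (1 + a) / a * r + (1 + a) / a ^+ 2] solves [G r - G r.+1 / (1 + a) = r]. *)
Lemma sum_natr_fdist (R : realType) (a : R) (m : nat) : 0 < a ->
  a * \sum_(0 <= r < m.+1) r%:R * fdist a m r =
  (1 + a) * (1 + a / (1 + a)) ^+ m * (a * m%:R / (2 * a + 1) + 1 / a)
  - (m.+1%:R + 1 / a).
Proof.
move=> a_gt0; have a0 := lt0r_neq0 a_gt0.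
have b_neq0 : 1 + a != 0 by rewrite gt_eqF// addr_gt0.
have c0 : 2 * a + 1 != 0 by apply: lt0r_neq0; lra.
rewrite (@sum_fdist_telescope _ _ m (fun r => r%:R)
  (fun r => (1 + a) / a * r%:R + (1 + a) / a ^+ 2))//; last first.
  by move=> r; rewrite -natr1; field; rewrite a0 b_neq0.
under eq_bigr do rewrite mulrDl -mulrA.
rewrite big_split/= -!big_distrr/= binomial_gf binomial_gf_deriv.
(* Restores the missing factor 1 + a / (1 + a) = (2a + 1) / (1 + a), which is where the slope a /
   (2a + 1) arises. At m = 0 the predecessor is truncated, but both sides vanish. *)
have -> : m%:R * (a / (1 + a)) * (1 + a / (1 + a)) ^+ m.-1 =
    a * m%:R / (2 * a + 1) * (1 + a / (1 + a)) ^+ m.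
  case: m => [|m]; first by rewrite !(mul0r, mulr0).
  by rewrite exprS /=; field; rewrite c0 b_neq0.
by rewrite -natr1; field; rewrite c0 a0 b_neq0.
Qed.

Lemma Sdist_gt0 (R : realType) (a : R) (m : nat) :
  0 < a -> 0 < Sdist a m.
Proof.
move=> a_gt0.
have x0 : 0 <= a / (1 + a) by rewrite divr_ge0// ?addr_ge0// ltW.
rewrite -(pmulr_rgt0 _ a_gt0) SdistE// subr_gt0.
have q1 : 1 <= (1 + a / (1 + a)) ^+ m by rewrite exprn_ege1// lerDl.
by apply: lt_le_trans (_ : 1 + a <= _); [lra | rewrite ler_peMr//; lra].
Qed.

Lemma mean_fdist_error (R : realType) (a : R) (m : nat) :
  0 < a -> (0 < m)%N ->
  `|(\sum_(0 <= r < m.+1) r%:R * fdist a m r) / Sdist a m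
    - (a * m%:R / (2 * a + 1) + 1 / a)| <= 2 * (1 + a) / a.
Proof.
move=> a_gt0 m0; set g := _ + 1 / a.
have a0 := lt0r_neq0 a_gt0.
have c0 : 0 < 2 * a + 1 by lra.
have b0 : 0 < 1 + a by lra.
have S0 := Sdist_gt0 m a_gt0.
have aS0 : 0 < a * Sdist a m by rewrite mulr_gt0.
(* The numerator is m + 1 + 1 / a - g, in which the terms 1 / a cancel. *)
have -> : (\sum_(0 <= r < m.+1) r%:R * fdist a m r) / Sdist a m - g =
    - (((1 + a) * m%:R / (2 * a + 1) + 1) / (a * Sdist a m)).
  set N := \sum_(_ <= _ < _) _.
  have -> : N = (a * Sdist a m * g + g - (m.+1%:R + 1 / a)) / a.
    by rewrite SdistE//; apply: (mulfI a0); rewrite sum_natr_fdist// -/g; field.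
  by rewrite /g -natr1; field; rewrite a0 !gt_eqF.
rewrite normrN ger0_norm; last first.
  by rewrite divr_ge0 ?(ltW aS0)// addr_ge0// divr_ge0 ?mulr_ge0// ltW.
rewrite ler_pdivrMr// SdistE//.
have m1 : 1 <= m%:R :> R by rewrite ler1n.
have xb : (1 + a) * (a / (1 + a)) = a by field; rewrite gt_eqF.
have := @bernoulli_ineq _ (a / (1 + a)) m (divr_ge0 (ltW a_gt0) (ltW b0)).
rewrite -(ler_pM2l b0) => bern.
have lb : m%:R * a <= (1 + a) * (1 + a / (1 + a)) ^+ m - 1.
  by move: bern; rewrite mulrDr mulrCA xb; lra.
(* For m >= 1, both summands of the numerator are at most (1 + a) m; hence the factor 2 in the
   bound. *)
apply: (@le_trans _ _ (2 * (1 + a) / a * (m%:R * a))); last first.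
  by rewrite ler_wpM2l// divr_ge0 ?mulr_ge0 ?ltW.
have -> : 2 * (1 + a) / a * (m%:R * a) = 2 * (1 + a) * m%:R by field.
have : (1 + a) * m%:R / (2 * a + 1) <= (1 + a) * m%:R.
  by rewrite ler_pdivrMr// ler_peMr ?mulr_ge0 ?ltW//; lra.
have : 0 <= a * m%:R by rewrite mulr_ge0// ltW.
by lra.
Qed.

(** As the masses sum to 1, the complement of the disjoint union [D] of the fibres [F r] is null and
    contributes nothing to the integral; on each [F r] the variable is constant. *)
Lemma expectation_nat_valued (R : realType) (d : measure_display)
    (T : measurableType d) (P : probability T R) (X : {RV P >-> R})
    (n : nat) (p : nat -> R) :
  (forall r, (r < n)%N -> P (X @^-1` [set r%:R]) = (p r)%:E) ->
  \sum_(0 <= r < n) p r = 1 ->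
  ('E_P[X] = (\sum_(0 <= r < n) r%:R * p r)%:E)%E.
Proof.
move=> Xp p1.
pose F r := X @^-1` [set r%:R].
have mF r : measurable (F r).
  by rewrite -[F r]setTI; exact: measurable_funP.
have tF (A : set nat) : trivIset A F.
  move=> i j _ _ [x []]; rewrite /F /preimage/= => ->.
  by move/eqP; rewrite eqr_nat => /eqP.
pose D := \big[setU/set0]_(0 <= r < n) F r.
have mD : measurable D by exact: bigsetU_measurable.
have PD : P D = 1%E.
  rewrite /D big_mkord measure_bigsetU//.
  rewrite -p1 -sumEFin big_mkord; apply: eq_bigr => i _; exact: Xp.
have PDC : P (~` D) = 0%E by rewrite probability_setC// PD subee.
have mX (A : set T) : measurable_fun A X by exact: measurable_funTS.
rewrite expectation_def -(setUv D) integral_setU//=; last 3 first.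
- exact: measurableC.
- exact/measurable_EFinP.
- by rewrite disj_set2E setICr.
rewrite [X in (_ + X)%E]null_set_integral//; last 2 first.
- exact: measurableC.
- exact/measurable_EFinP.
rewrite adde0 integral_bigsetU_EFin//; last 2 first.
- exact: iota_uniq.
- exact/measurable_EFinP.
rewrite -sumEFin big_nat_cond [in RHS]big_nat_cond; apply: eq_bigr => r.
rewrite andbT => /andP[_ rn].
rewrite (@eq_integral _ _ _ _ _ (cst (r%:R)%:E)).
  by rewrite integral_cst// EFinM -Xp.
by move=> x; rewrite inE /F /preimage/= => ->.
Qed.

Theorem theorem6p1 (R : realType) (a : R) (a_gt0 : 0 < a)
    (d : nat -> measure_display) (T : forall m, measurableType (d m))
    (P : forall m, probability (T m) R) (X : forall m, {RV (P m) >-> R})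
    (X_law : forall m, (0 < m)%N -> has_law_f a m (X m)) :
  (fun m : nat => fine ('E_(P m)[X m])%E) ~_\oo
  (fun m : nat => a * m%:R / (2 * a + 1) + 1 / a).
Proof.
apply/eqaddoP => e e0.
have c0 : 0 < 2 * a + 1 by lra.
near=> m.
have m0 : (0 < m)%N by near: m; exact: nbhs_infty_gt.
rewrite !fctE (@expectation_nat_valued _ _ _ _ _ m.+1
  (fun r => fdist a m r / Sdist a m)); last 2 first.
- by move=> r; rewrite ltnS; exact: X_law.
- by rewrite -mulr_suml -/(Sdist a m) divff// gt_eqF// Sdist_gt0.
rewrite /=; under eq_bigr do rewrite mulrA.
rewrite -mulr_suml; apply: le_trans (mean_fdist_error a_gt0 m0) _.
rewrite ger0_norm; last first.
  by rewrite addr_ge0 ?divr_ge0 ?mulr_ge0 ?ler0n ?(ltW a_gt0) ?(ltW c0).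
rewrite -ler_pdivrMl//.
(* The linear term alone eventually exceeds the constant error bound divided by [e]; solving for m
   gives the explicit threshold. *)
apply: le_trans (_ : a * m%:R / (2 * a + 1) <= _); last first.
  by rewrite lerDl divr_ge0// ltW.
rewrite ler_pdivlMr// -ler_pdivrMl//.
near: m; exact: nbhs_infty_ger.
Unshelve. all: by end_near.
Qed.
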